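(* Let $G$ be a group and $(X,\pi)$ a uniformly convex isometric Banach $G$-module. Let $\Phi$ denote the FC-centre of $G$ and assume that $X$ has no almost invariant unit vectors as a $\Phi$-module. Then the cochain complex $$\{0\}\longrightarrow C^0(G,X)\overset{\partial^1}\longrightarrow C^1(G,X)\overset{\partial^2}\longrightarrow C^2(G,X)\overset{\partial^3}\longrightarrow C^3(G,X)\overset{\partial^4}\longrightarrow\cdots$$ is split exact.
   Context: All Banach spaces are real and groups are discrete. A Banach $G$-module is a pair $(X,\pi)$ with $X$ a Banach space and $\pi$ an action of $G$ on $X$ by bounded linear automorphisms; it is isometric if each $\pi(g)$ is an isometry, and uniformly convex if $X$ is: for every $\epsilon>0$ there is $\delta>0$ with $\|\frac{x+y}2\|\leqslant 1-\delta$ whenever $\|x\|=\|y\|=1$ and $\|x-y\|\geqslant\epsilon$. The FC-centre of $G$ is the normal subgroup $\Phi$ of all $g\in G$ whose conjugacy class in $G$ is finite. For a group $H$, an isometric Banach $H$-module $(X,\pi)$ has almost invariant unit vectors if for all finite $E\subseteq H$ and $\epsilon>0$ there is a unit vector $x\in X$ with $\|x-\pi(h)x\|<\epsilon$ for all $h\in E$. $X$ is a $\Phi$-module by restricting $\pi$. $C^n(G,X)$ is the vector space of all maps $G^n\to X$ (with $C^0(G,X)=X$), with the topology of pointwise convergence. The coboundary operator $\partial^{n+1}:C^n(G,X)\to C^{n+1}(G,X)$ is $$(\partial^{n+1}\phi)(g_1,\ldots,g_{n+1})=-\pi(g_1)\phi(g_2,\ldots,g_{n+1})+(-1)^n\phi(g_1,\ldots,g_n)-\sum_{i=1}^n(-1)^i\phi(g_1,\ldots,g_{i-1},g_ig_{i+1},g_{i+2},\ldots,g_{n+1}),$$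 and $\partial^0:\{0\}\to C^0(G,X)$ is the zero map. $Z^n(G,X)=\ker\partial^{n+1}$ and $B^n(G,X)=\operatorname{range}\partial^n$. The complex is split exact if, for all $n\geqslant 0$, $B^n(G,X)=Z^n(G,X)$ and $B^n(G,X)$ is complemented in $C^n(G,X)$, i.e. is the range of a continuous linear projection of $C^n(G,X)$. *)

(* Defs.v *)
From HB Require Import structures.
From mathcomp Require Import all_boot all_order all_algebra.
From mathcomp Require Import all_classical all_reals all_analysis.

Set Implicit Arguments.
Unset Strict Implicit.
Unset Printing Implicit Defensive.

Import Order.TTheory GRing.Theory Num.Theory.
Import numFieldNormedType.Exports.

Local Open Scope classical_set_scope.
Local Open Scope ring_scope.

(* Bounded linear maps are given as continuous linear maps; bijectivity of each
   [mact g] follows from the action laws, the inverse being [mact g^-1]. *)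
Record banach_module (R : realType) (G : groupType)
    (X : completeNormedModType R) := BanachModule {
  mact :> G -> {linear X -> X};
  mact_continuous : forall g : G, continuous (mact g);
  mact1 : forall x : X, mact 1%g x = x;
  mactM : forall (g h : G) (x : X), mact (g * h)%g x = mact g (mact h x) }.

Definition isometric_module (R : realType) (G : groupType)
    (X : completeNormedModType R) (pi : banach_module G X) : Prop :=
  forall (g : G) (x y : X), `|pi g x - pi g y| = `|x - y|.

Definition uniformly_convex (R : realType) (X : normedModType R) : Prop :=
  forall e : R, 0 < e -> exists2 d : R, 0 < d &
    forall x y : X, `|x| = 1 -> `|y| = 1 -> e <= `|x - y| ->
      `|2^-1 *: (x + y)| <= 1 - d.

Definition FC_centre (G : groupType) : set G :=
  [set g | finite_set [set (g ^ h)%g | h in [set: G]]].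
Arguments FC_centre : clear implicits.

(* Almost invariant unit vectors of [X] seen, by restriction of [pi], as a
   module over the subgroup [H] of [G]. *)
Definition almost_invariant_unit_vectors (R : realType) (G : groupType)
    (X : completeNormedModType R) (pi : banach_module G X) (H : set G) : Prop :=
  forall (E : set G) (e : R), finite_set E -> E `<=` H -> 0 < e ->
    exists2 x : X, `|x| = 1 & forall h : G, E h -> `|x - pi h x| < e.

(* [G^n] is [n.-tuple G]; for [n = 0] this is a singleton, so that
   [cochain G X 0] is [X] up to evaluation at the empty tuple. *)
Definition cochain (R : realType) (G : groupType) (X : completeNormedModType R)
    (n : nat) : Type := n.-tuple G -> X.

HB.instance Definition _ (R : realType) (G : groupType)
    (X : completeNormedModType R) (n : nat) :=
  GRing.Lmodule.copy (cochain G X n) (n.-tuple G -> X).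
HB.instance Definition _ (R : realType) (G : groupType)
    (X : completeNormedModType R) (n : nat) :=
  Topological.copy (cochain G X n) {ptws n.-tuple G -> X}.

(* With 0-based positions, [lift ord_max j] is [j] and [lift ord0 j] is [j + 1]
   in ['I_n.+1]. *)
Definition drop_last (G : groupType) (n : nat) (g : n.+1.-tuple G) :
    n.-tuple G :=
  [tuple tnth g (lift ord_max j) | j < n].

(* (g_1, ..., g_{k-1}, g_k g_{k+1}, g_{k+2}, ..., g_{n+1}) for k = i + 1. *)
Definition merge_at (G : groupType) (n : nat) (i : 'I_n) (g : n.+1.-tuple G) :
    n.-tuple G :=
  [tuple if (j < i)%N then tnth g (lift ord_max j)
         else if j == i then (tnth g (lift ord_max j) * tnth g (lift ord0 j))%g
         else tnth g (lift ord0 j) | j < n].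

(* [coboundary pi n] is the operator from degree [n] to degree [n + 1]. *)
Definition coboundary (R : realType) (G : groupType)
    (X : completeNormedModType R) (pi : banach_module G X) (n : nat)
    (phi : cochain G X n) : cochain G X n.+1 :=
  fun g => - pi (thead g) (phi (behead_tuple g))
           + (-1) ^+ n *: phi (drop_last g)
           - \sum_(i < n) (-1) ^+ i.+1 *: phi (merge_at i g).

Definition cocycles (R : realType) (G : groupType)
    (X : completeNormedModType R) (pi : banach_module G X) (n : nat) :
    set (cochain G X n) :=
  [set phi | coboundary pi phi = 0].
Arguments cocycles {R G X} pi n.

Definition coboundaries (R : realType) (G : groupType)
    (X : completeNormedModType R) (pi : banach_module G X) (n : nat) :
    set (cochain G X n) :=
  match n with
  | 0 => [set 0]
  | m.+1 => range (@coboundary R G X pi m)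
  end.
Arguments coboundaries {R G X} pi n.

Definition complemented (R : realType) (G : groupType)
    (X : completeNormedModType R) (n : nat) (B : set (cochain G X n)) : Prop :=
  exists P : {linear cochain G X n -> cochain G X n},
    [/\ continuous P, forall phi, P (P phi) = P phi & range P = B].

Definition split_exact (R : realType) (G : groupType)
    (X : completeNormedModType R) (pi : banach_module G X) : Prop :=
  forall n : nat,
    coboundaries pi n = cocycles pi n /\ complemented (coboundaries pi n).

(* Main.v *)
From HB Require Import structures.
Require Import Defs.
From mathcomp Require Import all_boot all_order all_algebra.
From mathcomp Require Import all_classical all_reals all_analysis.

Set Implicit Arguments.
Unset Strict Implicit.
Unset Printing Implicit Defensive.

Import Order.TTheory GRing.Theory Num.Theory.
Import numFieldNormedType.Exports.

Local Open Scope classical_set_scope.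
Local Open Scope ring_scope.

(** The complex has a continuous linear contracting homotopy, built from a
    finite set [s] of elements of the FC-centre [Phi].

    Since [X] has no almost invariant unit vectors over [Phi], some finite
    subset of [Phi] moves every unit vector by a fixed amount; its closure under
    conjugation by [G], with [1] added, is still finite, because conjugacy
    classes of elements of [Phi] are finite.  This is [s]
    ([FC_displacing_seq]).  A unit vector [x] is at distance at least [e] from
    [pi h x] for some [h] in [s], so by uniform convexity the midpoint of [x]
    and [pi h x] has norm at most [1 - d]; hence the average of the [pi h],
    [h] in [s], has operator norm less than [1] ([average_norm]).  Therefore
    [B x = \sum_(h <- s) (x - pi h x)] has a continuous inverse [T]
    ([bounded_inverse]), and [T] commutes with the action of [G] because [s] is
    invariant under conjugation ([inverse_commute]).

    On the algebraic side, put
    [(S phi)(g_1, ..., g_n) = \sum_(h <- s) \sum_(i <= n)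
       (-1)^i phi(g_1, ..., g_i, h, g_{i+1}, ..., g_n)].
    The conjugation invariance of [s] gives [d S + S d = B], with [B] applied to
    the values of a cochain ([coboundary_insertion]): this is the prism homotopy
    between the identity and left translation by [h] of homogeneous cochains;
    a single [h] does not preserve equivariance, but the sum over [s] does.
    So [sigma = S T] satisfies [d sigma + sigma d = 1]; then cocycles are
    coboundaries and [d sigma] is a continuous projection onto them
    ([split_exact_of_contraction]).

    The identity [d S + S d = B] is proved for functions on finite sequences,
    where the part of the coboundary not involving the action, [faces], obeys a
    recursion on the sequence. *)

(** * Alternating sums over faces and insertions *)

(** [abelian] proves identities between signed sums in an abelian group: it
    moves all terms to the left and cancels the last one with its opposite as
    long as this is possible. *)
Ltac cancel_last :=
  match goal with
  | |- is_true (_ + (- ?t) == 0)%R =>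
      repeat first [rewrite (addrK t) | rewrite (addrAC _ t)]
  | |- is_true (_ + ?t == 0)%R =>
      repeat first [rewrite (subrK t) | rewrite (addrAC _ (- t))]
  end.
Ltac abelian :=
  apply/eqP; rewrite -subr_eq0 -[eqbLHS]add0r ?(opprD, opprK, addrA, subr0);
  do ?[progress cancel_last]; rewrite ?eqxx //.

Section AlternatingSums.
Variables (G : groupType) (K : nzRingType) (V : lmodType K).
Implicit Types (f : seq G -> V) (g h : G) (l s : seq G).

(** [faces f (g_1, ..., g_n)] is
    [\sum_(0 < i < n) (-1)^i f(..., g_i g_{i+1}, ...)
     + (-1)^n f(g_1, ..., g_{n-1})],
    that is, up to sign, the coboundary of [f] without its first term; it is [0]
    on the empty sequence.  The recursion splits off the face multiplying [g_1]
    and [g_2]. *)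
Fixpoint faces_rec f l : V :=
  if l is g1 :: l1 then
    - ((if l1 is g2 :: l2 then f ((g1 * g2)%g :: l2) else f [::])
       + faces_rec (fun m => f (g1 :: m)) l1)
  else 0.

(* Locked, so that unification does not unfold [faces] to an opposite when
   rewriting with lemmas such as [opprK]. *)
Definition faces := locked faces_rec.

Lemma faces0 f : faces f [::] = 0.
Proof. by rewrite /faces -lock. Qed.

Lemma faces1 f g : faces f [:: g] = - f [::].
Proof. by rewrite /faces -lock /= addr0. Qed.

Lemma faces_cons f g1 g2 l :
  faces f (g1 :: g2 :: l) =
  - f ((g1 * g2)%g :: l) - faces (fun m => f (g1 :: m)) (g2 :: l).
Proof. by rewrite /faces -lock -opprD. Qed.

Lemma eq_faces f f' l :
  (forall m, size m = (size l).-1 -> f m = f' m) -> faces f l = faces f' l.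
Proof.
elim: l f f' => [|g1 [|g2 l] IHl] f f' ff'; first by rewrite !faces0.
  by rewrite !faces1 ff'.
rewrite !faces_cons ff' //; congr (_ - _).
by apply: IHl => m szm; apply: ff'; rewrite /= szm.
Qed.

Lemma facesN f l : faces (fun m => - f m) l = - faces f l.
Proof.
elim: l f => [|g1 [|g2 l] IHl] f; first by rewrite !faces0 oppr0.
  by rewrite !faces1.
by rewrite !faces_cons IHl opprD.
Qed.

Lemma facesD f f' l : faces (fun m => f m + f' m) l = faces f l + faces f' l.
Proof.
elim: l f f' => [|g1 [|g2 l] IHl] f f'; first by rewrite !faces0 addr0.
  by rewrite !faces1 opprD.
by rewrite !faces_cons (IHl (fun m => f _)) !opprD addrACA.
Qed.

Lemma facesB f f' l : faces (fun m => f m - f' m) l = faces f l - faces f' l.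
Proof. by rewrite facesD facesN. Qed.

Lemma faces_sum s (F : G -> seq G -> V) l :
  faces (fun m => \sum_(h <- s) F h m) l = \sum_(h <- s) faces (F h) l.
Proof.
elim: s => [|h s IHs].
  rewrite big_nil -[RHS](subrr (faces (fun=> 0) l)) -facesB.
  by apply: eq_faces => m _; rewrite big_nil subrr.
rewrite big_cons -IHs -facesD.
by apply: eq_faces => m _; rewrite big_cons.
Qed.

Lemma faces_additive f (u : {additive V -> V}) l :
  faces (u \o f) l = u (faces f l).
Proof.
elim: l f => [|g1 [|g2 l] IHl] f; first by rewrite !faces0 raddf0.
  by rewrite !faces1 (raddfN u).
by rewrite !faces_cons (raddfB u) (raddfN u) -IHl.
Qed.

Lemma faces_faces f g1 g2 l : faces (faces f) (g1 :: g2 :: l) = 0.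
Proof.
elim: l f g1 g2 => [|g3 l IHl] f g1 g2.
  by rewrite !(faces_cons, faces1); abelian.
rewrite -[RHS](IHl (fun m => f (g1 :: m)) g2 g3) !faces_cons.
have -> : (fun m => faces f [:: g1, g2 & m]) = (fun m =>
    - f ((g1 * g2)%g :: m) - faces (fun k => f (g1 :: k)) (g2 :: m)).
  by apply/funext => m; rewrite faces_cons.
by rewrite facesB facesN mulgA; abelian.
Qed.

(** The alternating sum of the values of [f] at the sequences obtained by
    inserting [h] at every position of [l], summed over [h] in [s]. *)
Definition insertion s f l : V :=
  \sum_(h <- s) \sum_(i < (size l).+1)
    (-1) ^+ i *: f (take i l ++ h :: drop i l).

Lemma insertion0 s f : insertion s f [::] = \sum_(h <- s) f [:: h].
Proof.
by apply: eq_bigr => h _; rewrite big_ord_recl big_ord0 scale1r addr0.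
Qed.

Lemma insertion_cons s f g l :
  insertion s f (g :: l) =
  \sum_(h <- s) f (h :: g :: l) - insertion s (fun m => f (g :: m)) l.
Proof.
rewrite /insertion -sumrB; apply: eq_bigr => h _.
rewrite big_ord_recl scale1r; congr (_ + _); rewrite -sumrN.
by apply: eq_bigr => i _; rewrite lift0 exprS mulN1r scaleNr.
Qed.

Lemma eq_insertion s f f' l :
  (forall m, size m = (size l).+1 -> f m = f' m) ->
  insertion s f l = insertion s f' l.
Proof.
move=> ff'; apply: eq_bigr => h _; apply: eq_bigr => i _; rewrite ff' //.
by rewrite size_cat /= addnS -size_cat cat_take_drop.
Qed.

Lemma insertionD s f f' l :
  insertion s (fun m => f m + f' m) l = insertion s f l + insertion s f' l.
Proof.
rewrite /insertion -big_split; apply: eq_bigr => h _ /=.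
by rewrite -big_split; apply: eq_bigr => i _; rewrite scalerDr.
Qed.

Lemma insertionN s f l : insertion s (fun m => - f m) l = - insertion s f l.
Proof.
rewrite /insertion -sumrN; apply: eq_bigr => h _.
by rewrite -sumrN; apply: eq_bigr => i _; rewrite scalerN.
Qed.

Lemma insertionB s f f' l :
  insertion s (fun m => f m - f' m) l = insertion s f l - insertion s f' l.
Proof. by rewrite insertionD insertionN. Qed.

Lemma insertion_linear s f (u : {linear V -> V}) l :
  insertion s (u \o f) l = u (insertion s f l).
Proof.
rewrite /insertion linear_sum; apply: eq_bigr => h _.
by rewrite linear_sum; apply: eq_bigr => i _; rewrite linearZ.
Qed.

(** Conjugation by any element permutes [s], with multiplicities. *)
Definition conj_invariant s := forall g, perm_eq [seq (h ^ g)%g | h <- s] s.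

Lemma conj_invariant_sum s (F : G -> V) g :
  conj_invariant s -> \sum_(h <- s) F (h * g)%g = \sum_(h <- s) F (g * h)%g.
Proof.
move=> /(_ g) sg; rewrite -[RHS](perm_big _ sg) big_map /=.
by apply: eq_bigr => h _; rewrite conjgE mulVKg.
Qed.

(** The prism identity.  By [insertion_cons] it says that, at nonempty sequences,
    [insertion s (faces f) + faces (insertion s f) = - N f] with [N = size s]; the
    form below suits the induction.  The terms with an argument [g_i h] only
    cancel those with an argument [h g_i] after summation over [s], by
    [conj_invariant_sum]. *)
Lemma insertion_faces s f g l : conj_invariant s ->
  insertion s (fun m => faces f (g :: m)) l =
  \sum_(h <- s) faces f (h :: g :: l) + faces (insertion s f) (g :: l)
  + f (g :: l) *+ size s.
Proof.
move=> cs; elim: l g f => [|g' l IHl] g f.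
  have El h : faces f [:: g; h] = f [:: g] - f [:: (g * h)%g].
    by rewrite faces_cons faces1; abelian.
  have Er h : faces f [:: h; g] = f [:: h] - f [:: (h * g)%g].
    by rewrite faces_cons faces1; abelian.
  rewrite insertion0 (eq_bigr _ (fun h _ => El h)).
  rewrite (eq_bigr _ (fun h _ => Er h)).
  rewrite faces1 insertion0 !sumrB (conj_invariant_sum (fun h => f [:: h])) //.
  by rewrite big_const_seq count_predT iter_addr_0; abelian.
pose fg m := f (g :: m); pose fgg m := f ((g * g')%g :: m).
have E1 : (fun m => faces f (g :: g' :: m)) =
          fun m => - fgg m - faces fg (g' :: m).
  by apply/funext => m; rewrite faces_cons.
have E2 h : faces f (h :: g :: g' :: l) = - f ((h * g)%g :: g' :: l)
    + f (h :: (g * g')%g :: l) + faces (fun m => f (h :: g :: m)) (g' :: l).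
  by rewrite !faces_cons; abelian.
have E3 h : faces f (g :: h :: g' :: l) =
    - f ((g * h)%g :: g' :: l) - faces fg (h :: g' :: l).
  by rewrite faces_cons.
have E4 : (fun m => insertion s f (g :: m)) =
    fun m => \sum_(h <- s) f (h :: g :: m) - insertion s fg m.
  by apply/funext => m; rewrite insertion_cons.
rewrite insertion_cons E1 insertionB insertionN IHl.
rewrite (eq_bigr _ (fun h _ => E3 h)) (eq_bigr _ (fun h _ => E2 h)).
rewrite faces_cons E4 facesB faces_sum insertion_cons.
rewrite !big_split /= !sumrN.
rewrite (conj_invariant_sum (fun x => f (x :: g' :: l))) //.
by abelian.
Qed.

End AlternatingSums.

(** * The homotopy on functions of finite sequences *)

Section SeqComplex.
Variables (R : realType) (G : groupType) (X : completeNormedModType R).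
Variable pi : banach_module G X.
Implicit Types (f : seq G -> X) (g h : G) (l s : seq G).

(** The coboundary of a function on sequences of all lengths; in degree [n] it
    only involves the values of [f] at sequences of length [n]. *)
Definition seq_coboundary f l : X :=
  if l is g :: m then - pi g (f m) - faces f l else 0.

Lemma eq_seq_coboundary f f' l :
  (forall m, size m = (size l).-1 -> f m = f' m) ->
  seq_coboundary f l = seq_coboundary f' l.
Proof. by case: l => [//|g l] ff' /=; rewrite ff' // (eq_faces ff'). Qed.

Lemma seq_coboundary_coboundary f g1 g2 l :
  seq_coboundary (seq_coboundary f) (g1 :: g2 :: l) = 0.
Proof.
have E : (fun m => seq_coboundary f (g1 :: m)) =
    fun m => - (pi g1 \o f) m - faces f (g1 :: m) by [].
have /eqP := faces_faces f g1 g2 l.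
rewrite faces_cons subr_eq add0r => /eqP E2.
rewrite /seq_coboundary faces_cons -/(seq_coboundary f).
rewrite E facesB facesN faces_additive -E2 mactM.
rewrite !(raddfB (pi g1)) !(raddfN (pi g1)).
by abelian.
Qed.

Lemma seq_homotopy s f l : conj_invariant s ->
  seq_coboundary (insertion s f) l + insertion s (seq_coboundary f) l =
  \sum_(h <- s) (f l - pi h (f l)).
Proof.
move=> cs; case: l => [|g l].
  rewrite add0r insertion0; apply: eq_bigr => h _ /=.
  by rewrite faces1 opprK addrC.
have E : (fun m => seq_coboundary f (g :: m)) =
    fun m => - (pi g \o f) m - faces f (g :: m) by [].
rewrite insertion_cons E insertionB insertionN insertion_linear.
rewrite insertion_faces //= !sumrB sumrN big_const_seq count_predT iter_addr_0.
by abelian.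
Qed.

End SeqComplex.

(** * The homotopy on cochains *)

Section Cochains.
Variables (R : realType) (G : groupType) (X : completeNormedModType R).
Variable pi : banach_module G X.

(** The extension by [0] of a cochain to sequences of all lengths. *)
Definition seq_of_cochain n (phi : cochain G X n) (l : seq G) : X :=
  oapp phi 0 (insub l).

Lemma seq_of_cochainE n (phi : cochain G X n) (t : n.-tuple G) :
  seq_of_cochain phi t = phi t.
Proof. by rewrite /seq_of_cochain valK. Qed.

Lemma merge_at_ord0 n g1 g2 (l : n.-tuple G) :
  merge_at ord0 [tuple of g1 :: g2 :: l] = [tuple of (g1 * g2)%g :: l].
Proof.
apply: eq_from_tnth => j; rewrite tnth_mktuple ltn0 !(tnth_nth g1) /=.
by case: (unliftP ord0 j) => [j' ->|->].
Qed.

Lemma merge_at_lift n (i : 'I_n) g (l : n.+1.-tuple G) :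
  merge_at (lift ord0 i) [tuple of g :: l] = [tuple of g :: merge_at i l].
Proof.
apply: eq_from_tnth => j; rewrite tnth_mktuple.
case: (unliftP ord0 j) => [j' ->|->]; last by rewrite !(tnth_nth g) /=.
rewrite [RHS]tnthS tnth_mktuple ltnS (inj_eq lift_inj) !(tnth_nth g) /=.
by rewrite !bumpS.
Qed.

Lemma drop_last_cons n g (l : n.+1.-tuple G) :
  drop_last [tuple of g :: l] = [tuple of g :: drop_last l].
Proof.
apply: eq_from_tnth => j; rewrite tnth_mktuple.
case: (unliftP ord0 j) => [j' ->|->]; last by rewrite !(tnth_nth g) /=.
rewrite [RHS]tnthS tnth_mktuple !(tnth_nth g) /=.
by rewrite !bumpS.
Qed.

Lemma faces_tuple n (f : seq G -> X) (t : n.+1.-tuple G) :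
  faces f t = \sum_(i < n) (-1) ^+ i.+1 *: f (merge_at i t)
              + (-1) ^+ n.+1 *: f (drop_last t).
Proof.
elim: n f t => [|n IHn] f t.
  case/tupleP: t => g t; rewrite big_ord0 add0r expr1 scaleN1r.
  by rewrite (tuple0 t) faces1 (tuple0 (drop_last _)).
case/tupleP: t => g1 t; rewrite drop_last_cons big_ord_recl.
under eq_bigr do rewrite merge_at_lift.
case/tupleP: t => g2 t; rewrite merge_at_ord0 faces_cons.
rewrite (IHn _ [tuple of g2 :: t]) expr1 scaleN1r opprD -addrA.
congr (_ + (_ + _)).
  rewrite -sumrN; apply: eq_bigr => i _.
  by rewrite lift0 [in RHS]exprS mulN1r scaleNr.
by rewrite [in RHS]exprS mulN1r scaleNr.
Qed.

Lemma coboundaryE n (phi : cochain G X n) (t : n.+1.-tuple G) :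
  coboundary pi phi t = seq_coboundary pi (seq_of_cochain phi) t.
Proof.
have -> : seq_coboundary pi (seq_of_cochain phi) t =
    - pi (thead t) (phi (behead_tuple t)) - faces (seq_of_cochain phi) t.
  case/tupleP: t => g t; rewrite /= -(seq_of_cochainE phi).
  by congr (- pi _ _ - _).
rewrite faces_tuple opprD seq_of_cochainE exprS mulN1r scaleNr opprK.
rewrite [X in _ = _ + X]addrC addrA; congr (_ + _ - _).
by apply: eq_bigr => i _; rewrite seq_of_cochainE.
Qed.

(** The homotopy [S]: insertion of the elements of [s] in the arguments of a
    cochain. *)
Definition cochain_insertion (s : seq G) n (phi : cochain G X n.+1) :
    cochain G X n :=
  fun t => insertion s (seq_of_cochain phi) t.

Lemma coboundary_coboundary n (phi : cochain G X n) :
  coboundary pi (coboundary pi phi) = 0.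
Proof.
apply/funext => t; rewrite coboundaryE.
rewrite (@eq_seq_coboundary _ _ _ _ _ (seq_coboundary pi (seq_of_cochain phi))).
  case/tupleP: t => g t; case/tupleP: t => g' t.
  exact: seq_coboundary_coboundary.
rewrite size_tuple => m /eqP szm.
by rewrite -(coboundaryE _ (Tuple szm)) -seq_of_cochainE.
Qed.

Lemma coboundary_insertion s n (phi : cochain G X n.+1) (t : n.+1.-tuple G) :
  conj_invariant s ->
  coboundary pi (cochain_insertion s phi) t
  + cochain_insertion s (coboundary pi phi) t
  = \sum_(h <- s) (phi t - pi h (phi t)).
Proof.
move=> cs; rewrite -(seq_of_cochainE phi t) -seq_homotopy // coboundaryE.
congr (_ + _).
  apply: eq_seq_coboundary; rewrite size_tuple => m /eqP szm.
  exact: (seq_of_cochainE _ (Tuple szm)).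
apply: eq_insertion; rewrite size_tuple => m /eqP szm.
by rewrite -(coboundaryE _ (Tuple szm)) -seq_of_cochainE.
Qed.

Lemma coboundary_insertion0 s (phi : cochain G X 0) (t : 0.-tuple G) :
  cochain_insertion s (coboundary pi phi) t
  = \sum_(h <- s) (phi t - pi h (phi t)).
Proof.
rewrite (tuple0 t) /cochain_insertion insertion0; apply: eq_bigr => h _.
rewrite (seq_of_cochainE _ [tuple h]) coboundaryE /= faces1 opprK addrC.
by rewrite -(seq_of_cochainE phi).
Qed.

End Cochains.

(** * Linear and continuous maps between spaces of cochains *)

Lemma linear_ex (K : pzRingType) (U V : lmodType K) (f : U -> V) :
  linear f -> exists F : {linear U -> V}, F =1 f.
Proof.
move=> flin.
pose m := GRing.isLinear.Build K U V *:%R f flin.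
by exists (HB.pack_for {linear U -> V} f m).
Qed.

Lemma linear_zero (K : pzRingType) (U V : lmodType K) (f : U -> V) :
  linear f -> f 0 = 0.
Proof. by move=> /linear_ex[F Ff]; rewrite -Ff linear0. Qed.

Section Complex.
Variables (R : realType) (G : groupType) (X : completeNormedModType R).
Variable pi : banach_module G X.

Lemma cochain_eval_continuous n (t : n.-tuple G) :
  continuous (fun phi : cochain G X n => phi t).
Proof. exact: (@proj_continuous _ (fun=> X) t). Qed.

Lemma cochain_continuous (Y : topologicalType) n (F : Y -> cochain G X n) :
  (forall t, continuous (fun y => F y t)) -> continuous F.
Proof.
move=> Fc y; apply/cvg_sup => t.
exact: (@continuous_comp_initial _ _ _ _ _ (Fc t)).
Qed.

Lemma continuous_sum (Y : topologicalType) I (r : seq I) (F : I -> Y -> X) :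
  (forall i, continuous (F i)) -> continuous (fun y => \sum_(i <- r) F i y).
Proof.
move=> Fc; apply: continuous_big => [|i _]; last exact: Fc.
exact: add_continuous.
Qed.

Lemma seq_of_cochain_continuous n l :
  continuous (fun phi : cochain G X n => seq_of_cochain phi l).
Proof.
rewrite /seq_of_cochain; case: insub => [t|] /=; last exact: cst_continuous.
exact: cochain_eval_continuous.
Qed.

Lemma continuous_scale (Y : topologicalType) (k : R) (F : Y -> X) :
  continuous F -> continuous (fun y => k *: F y).
Proof.
move=> Fc y.
by apply: continuous_comp; [exact: Fc|exact: scaler_continuous].
Qed.

Lemma coboundary_continuous n : continuous (@coboundary R G X pi n).
Proof.
apply: cochain_continuous => t phi; rewrite /coboundary.
have c1 : continuous
    (fun psi : cochain G X n => pi (thead t) (psi (behead_tuple t))).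
  move=> psi; apply: (@continuous_comp _ _ _
      (fun psi : cochain G X n => psi (behead_tuple t)) (pi (thead t))).
    exact: cochain_eval_continuous.
  exact: mact_continuous.
have c2 := @continuous_scale _ ((-1) ^+ n) _
  (@cochain_eval_continuous n (drop_last t)).
have c3 := @continuous_sum (cochain G X n) _ (index_enum 'I_n)
    (fun i psi => (-1) ^+ i.+1 *: psi (merge_at i t))
    (fun i => @continuous_scale _ _ _ (@cochain_eval_continuous n _)).
exact: (cvgB (cvgD (cvgN (c1 phi)) (c2 phi)) (c3 phi)).
Qed.

Lemma cochain_insertion_continuous (s : seq G) n :
  continuous (@cochain_insertion R G X s n).
Proof.
apply: cochain_continuous => t.
apply: (@continuous_sum _ _ s (fun h (phi : cochain G X n.+1) => _)) => h.
apply: (@continuous_sum _ _ _ (fun i (phi : cochain G X n.+1) => _)) => i.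
apply: continuous_scale; exact: seq_of_cochain_continuous.
Qed.

Lemma coboundary_linear n : linear (@coboundary R G X pi n).
Proof.
move=> a phi psi; apply/funext => t.
have combE m (u v : cochain G X m) r : (a *: u + v) r = a *: u r + v r by [].
rewrite combE /coboundary !combE linearP /=.
have -> : \sum_(i < n) (-1) ^+ i.+1 *: (a *: phi + psi) (merge_at i t) =
    a *: \sum_(i < n) (-1) ^+ i.+1 *: phi (merge_at i t)
    + \sum_(i < n) (-1) ^+ i.+1 *: psi (merge_at i t).
  rewrite scaler_sumr -big_split; apply: eq_bigr => i _ /=.
  by rewrite combE scalerDr !scalerA mulrC.
rewrite scalerBr !scalerDr !scalerN !scalerA [a * _]mulrC.
by abelian.
Qed.

Lemma cochain_insertion_linear (s : seq G) n :
  linear (@cochain_insertion R G X s n).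
Proof.
move=> a phi psi; apply/funext => t.
have E : seq_of_cochain (a *: phi + psi) =
    fun l => ((fun x : X => a *: x) \o seq_of_cochain phi) l
             + seq_of_cochain psi l.
  apply/funext => l; rewrite /seq_of_cochain /=; case: insub => [//|] /=.
  by rewrite scaler0 addr0.
rewrite /cochain_insertion E insertionD.
by rewrite (insertion_linear _ _ ( *:%R a)).
Qed.

(** A contracting homotopy [sigma] splits the complex: [d sigma] is a projection
    onto the coboundaries. *)
Lemma split_exact_of_contraction
    (sigma : forall n, cochain G X n.+1 -> cochain G X n) :
    (forall n, linear (@sigma n)) -> (forall n, continuous (@sigma n)) ->
    (forall phi : cochain G X 0, sigma 0%N (coboundary pi phi) = phi) ->
    (forall n (phi : cochain G X n.+1),
      coboundary pi (sigma n phi) + sigma n.+1 (coboundary pi phi) = phi) ->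
  split_exact pi.
Proof.
move=> slin scont s0 sS [|n].
  have sigma0 : sigma 0%N 0 = 0 by exact: linear_zero (slin 0%N).
  split.
    apply/seteqP; split => phi; rewrite /cocycles /=.
      by move=> ->; exact: linear_zero (@coboundary_linear 0).
    by move=> dphi; rewrite -(s0 phi) dphi sigma0.
  exists \0; split=> // [|].
    exact: cst_continuous.
  by apply/seteqP; split => phi /= => [[psi _ <-]//|->]; exists 0.
have sigma0 m : sigma m 0 = 0 by exact: linear_zero (slin m).
have dsd (phi : cochain G X n) :
    coboundary pi (sigma n (coboundary pi phi)) = coboundary pi phi.
  by rewrite -[RHS]sS coboundary_coboundary sigma0 addr0.
split.
  apply/seteqP; split => phi; rewrite /cocycles /=.
    by move=> [psi _ <-]; exact: coboundary_coboundary.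
  move=> dphi; exists (sigma n phi) => //.
  by rewrite -[RHS]sS dphi sigma0 addr0.
have [|P PE] := @linear_ex R (cochain G X n.+1) (cochain G X n.+1)
    (fun phi => coboundary pi (sigma n phi)).
  by move=> a phi psi; rewrite slin coboundary_linear.
exists P; split.
- rewrite (funext PE) => phi.
  by apply: continuous_comp; [exact: scont|exact: coboundary_continuous].
- by move=> phi; rewrite !PE dsd.
- apply/seteqP; split => phi /= [psi _ <-].
    by rewrite PE; exists (sigma n psi).
  by exists (coboundary pi psi); rewrite // PE dsd.
Qed.

End Complex.

(** * Averaging over a finite conjugation-invariant set *)

(** A linear map [B] with [1 - c B] of norm at most [q < 1] has a continuous
    inverse. *)
Lemma bounded_inverse (R : realType) (X : completeNormedModType R)
    (B : {linear X -> X}) (c q : R) :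
    c != 0 -> 0 <= q < 1 -> (forall x, `|x - c *: B x| <= q * `|x|) ->
  exists T : {linear X -> X}, [/\ continuous T, cancel T B & cancel B T].
Proof.
move=> c0 /andP[q0 q1] Bq.
have Binj : injective B.
  move=> x y Bxy; apply/subr0_eq/normr0_eq0/eqP; apply: contraT => xy0.
  have xy_gt0 : 0 < `|x - y| by rewrite lt_def xy0 normr_ge0.
  have := Bq (x - y); rewrite linearB Bxy subrr scaler0 subr0.
  by rewrite leNgt gtr_pMl ?q1.
(* A solution of [B x = y] is a fixed point of [x - c B x + c y], which is a
   [q]-contraction. *)
have Bsurj y : exists x, B x = y.
  pose f x := x - c *: B x + c *: y.
  have f_ctr : is_contraction (totalfun f : {fun [set: X] >-> [set: X]}).
    exists (NngNum q0); split => //= -[x x'] _ /=.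
    have -> : f x - f x' = x - x' - c *: B (x - x'); last exact: Bq.
    by rewrite /f linearB scalerBr; abelian.
  have [x _ fx] := banach_fixed_point f_ctr closedT (ex_intro _ y I).
  have {fx} : x + c *: B x = x + c *: y.
    by rewrite {1}(fx : x = f x) /f addrAC subrK.
  by move=> /addrI/(scalerI c0) Bx; exists x.
have [T TK] := choice Bsurj.
have BK : cancel B T by move=> x; apply: Binj; rewrite TK.
have [|F FT] := @linear_ex R X X T.
  by move=> a x y; apply: Binj; rewrite TK linearP !TK.
exists F; split; last 2 first.
- by move=> x; rewrite FT.
- by move=> x; rewrite FT.
apply: bounded_linear_continuous; apply/bounded_funP => r.
exists (`|c| / (1 - q) * r) => y yr.
rewrite FT; apply: le_trans (_ : `|c| / (1 - q) * `|y| <= _); last first.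
  by rewrite ler_wpM2l // divr_ge0 ?subr_ge0 // ltW.
rewrite mulrAC ler_pdivlMr ?subr_gt0 // mulrBr mulr1 lerBlDr [_ * q]mulrC.
rewrite -normrZ -[in c *: y](TK y) -lerBlDl.
by apply: le_trans (Bq _); rewrite lerB_dist.
Qed.

Section Averaging.
Variables (R : realType) (G : groupType) (X : completeNormedModType R).
Variable pi : banach_module G X.

(** Without almost invariant unit vectors over the FC-centre, some finite set
    [s], closed under conjugation by the whole group, moves every unit vector: one
    of its elements moves it by at least [e]. *)
Lemma FC_displacing_seq : ~ almost_invariant_unit_vectors pi (FC_centre G) ->
  exists (s : seq G) (e : R),
    [/\ uniq s, conj_invariant s, 1%g \in s, 0 < e &
        forall x, `|x| = 1 -> exists2 h, h \in s & e <= `|x - pi h x|].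
Proof.
move=> /existsNP[E /existsNP[e /not_implyP[finE /not_implyP[EPhi
  /not_implyP[e0 noinv]]]]].
(* The union of the conjugacy classes of [1] and of the elements of [E]. *)
pose D := \bigcup_(g in E `|` [set 1%g]) [set (g ^ h)%g | h in [set: G]].
have /finite_seqP[r Dr] : finite_set D.
  apply: bigcup_finite; first by rewrite finite_setU; split.
  move=> g [/EPhi//|->]; apply: (@sub_finite_set _ _ [set 1%g]) => //.
  by move=> _ [h _ <-]; rewrite conj1g.
have memD x : x \in undup r <-> D x by rewrite mem_undup Dr.
exists (undup r), e; split => //.
- exact: undup_uniq.
- move=> g; have conjg_inj : injective (fun h => (h ^ g)%g).
    by move=> x y /=; rewrite !conjgE => /mulgI /mulIg.
  apply: uniq_perm; rewrite ?map_inj_uniq ?undup_uniq //.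
  have sub k x : D x -> D (x ^ k)%g.
    move=> [z Ez [h _ <-]]; exists z => //.
    by exists (h * k)%g; rewrite ?conjgM.
  move=> x; apply/mapP/idP => [[y /memD Dy ->]|/memD Dx].
    by apply/memD; exact: sub.
  by exists (x ^ g^-1)%g; [apply/memD; exact: sub|rewrite conjgKV].
- by apply/memD; exists 1%g; [right|exists 1%g; rewrite ?conj1g].
- move=> x x1; apply: contrapT => nh; apply: noinv; exists x => // h Eh.
  rewrite ltNge; apply/negP => eh; apply: nh; exists h => //.
  by apply/memD; exists h; [left|exists 1%g; rewrite ?conjg1].
Qed.

(** Uniform convexity makes the average over [s] a strict contraction. *)
Lemma average_norm (s : seq G) (e : R) :
    uniformly_convex X -> isometric_module pi ->
    uniq s -> 1%g \in s -> 0 < e ->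
    (forall x, `|x| = 1 -> exists2 h, h \in s & e <= `|x - pi h x|) ->
  exists2 q : R, 0 <= q < 1 &
    forall x, `|(size s)%:R^-1 *: \sum_(h <- s) pi h x| <= q * `|x|.
Proof.
move=> uc iso us s1 e0 mov.
have piN h x : `|pi h x| = `|x|.
  by have := iso h x 0; rewrite linear0 !subr0.
have [d d0 dP] := uc e e0.
have s_gt0 : (0 < size s)%N by case: (s) s1.
(* Capping [d] at [1/2] keeps the constant [1 - 2 d' / N] nonnegative even in the
   zero space, where [d] can be arbitrarily large. *)
pose d' := Num.min d 2^-1.
have d'0 : 0 < d' by rewrite lt_min d0 /=.
pose N : R := (size s)%:R.
have N0 : 0 < N by rewrite ltr0n.
have N1 : 1 <= N by rewrite ler1n.
exists (1 - 2 * d' / N).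
  rewrite subr_ge0 ler_pdivrMr // mul1r ltrBlDr ltrDl.
  rewrite divr_gt0 ?mulr_gt0 // andbT.
  rewrite (le_trans _ N1) // -ler_pdivlMl // mulr1.
  by rewrite ge_min lexx orbT.
have unit x : `|x| = 1 -> `|\sum_(h <- s) pi h x| <= N - 2 * d'.
  move=> x1; have [h hs eh] := mov x x1.
  have h1 : h != 1%g.
    by apply: contraTneq eh => ->; rewrite mact1 subrr normr0 -ltNge.
  have hs1 : h \in rem 1%g s by rewrite mem_rem_uniq // inE h1.
  (* Pair the terms at [1] and [h]; the other [N - 2] terms have norm [1]. *)
  rewrite (big_rem _ s1) (big_rem _ hs1) /= mact1 addrA.
  apply: le_trans (ler_normD _ _) _.
  have pair : `|x + pi h x| <= 2 - 2 * d'.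
    have := dP x (pi h x) x1; rewrite piN => /(_ x1 eh).
    rewrite normrZ ger0_norm ?invr_ge0 // ler_pdivrMl // => le1.
    apply: le_trans le1 _; rewrite mulrBr mulr1 lerB // ler_pM2l //.
    by rewrite ge_min lexx.
  have rest : `|\sum_(i <- rem h (rem 1%g s)) pi i x| <= N - 2.
    apply: le_trans (ler_norm_sum _ _ _) _.
    under eq_bigr do rewrite piN x1.
    rewrite big_const_seq count_predT iter_addr_0 !size_rem //.
    have : (1 < size s)%N.
      by rewrite -subn_gt0 subn1 -(size_rem s1); case: (rem _ _) hs1.
    rewrite /N; case: (size s) => [|[|k]] //= _.
    by rewrite -addn2 natrD addrK.
  have -> : N - 2 * d' = 2 - 2 * d' + (N - 2) by abelian.
  exact: lerD.
move=> x; have [->|x0] := eqVneq x 0.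
  by rewrite big1 ?scaler0 ?normr0 ?mulr0 // => h _; rewrite linear0.
have nx0 : `|x| != 0 by rewrite normr_eq0.
have -> : \sum_(h <- s) pi h x = `|x| *: \sum_(h <- s) pi h (`|x|^-1 *: x).
  rewrite scaler_sumr; apply: eq_bigr => h _.
  by rewrite -linearZ scalerA divff // scale1r.
rewrite !normrZ normr_id mulrCA mulrC ler_wpM2r //.
rewrite ger0_norm ?invr_ge0 ?ler0n // -/N.
apply: le_trans (ler_wpM2l _ (unit _ _)) _.
- by rewrite invr_ge0 ltW.
- by rewrite normrZ normfV normr_id mulVf.
by rewrite mulrBr mulVf ?gt_eqF // mulrC.
Qed.

Lemma inverse_commute (s : seq G) (B T : {linear X -> X}) g x :
  conj_invariant s -> (forall y, B y = \sum_(h <- s) (y - pi h y)) ->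
  cancel T B -> cancel B T -> T (pi g x) = pi g (T x).
Proof.
move=> cs BE TK BK; apply: (can_inj BK); rewrite TK BE.
rewrite -{1}(TK x) BE raddf_sum /=.
under eq_bigr do rewrite raddfB /= -mactM.
rewrite !sumrB; congr (_ - _).
rewrite -(conj_invariant_sum (fun h => pi h (T x))) //.
by apply: eq_bigr => h _; rewrite mactM.
Qed.

End Averaging.

Theorem theorem1p3 (R : realType) (G : groupType)
    (X : completeNormedModType R) (pi : banach_module G X) :
  uniformly_convex X ->
  isometric_module pi ->
  ~ almost_invariant_unit_vectors pi (FC_centre G) ->
  split_exact pi.
Proof.
move=> uc iso /FC_displacing_seq[s [e [us cs s1 e0 mov]]].
have [q q01 qP] := average_norm uc iso us s1 e0 mov.
(* [N^-1 B] is the identity minus the average over [s], with [N = size s]. *)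
have [|B BE] := @linear_ex R X X (fun x => \sum_(h <- s) (x - pi h x)).
  move=> a x y; rewrite scaler_sumr -big_split; apply: eq_bigr => h _ /=.
  by rewrite linearP scalerBr; abelian.
have N0 : (size s)%:R != 0 :> R by rewrite pnatr_eq0; case: (s) s1.
have [||T [Tc TK BK]] := @bounded_inverse R X B (size s)%:R^-1 q _ q01.
- by rewrite invr_eq0.
- move=> x; apply: le_trans (qP x).
  rewrite BE sumrB big_const_seq count_predT iter_addr_0 scalerBr.
  rewrite -(scaler_nat _ x).
  by rewrite scalerA mulVf // scale1r opprB addrC subrK.
have Tpi g x : T (pi g x) = pi g (T x) by exact: inverse_commute TK BK.
have Tcob n (phi : cochain G X n) :
    T \o coboundary pi phi = coboundary pi (T \o phi).
  apply/funext => t; rewrite /coboundary /= linearB linearD linearN linear_sum.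
  rewrite Tpi linearZ; congr (_ - _); apply: eq_bigr => i _.
  by rewrite linearZ.
apply: (@split_exact_of_contraction R G X pi
  (fun n phi => cochain_insertion s (T \o phi : cochain G X n.+1))).
- move=> n a phi psi; rewrite -cochain_insertion_linear.
  congr cochain_insertion.
  by apply/funext => t; rewrite /= linearP.
- move=> n phi.
  apply: (@continuous_comp _ _ _
    (fun psi : cochain G X n.+1 => T \o psi : cochain G X n.+1)
    (@cochain_insertion R G X s n)).
    apply: cochain_continuous => t psi.
    by apply: continuous_comp; [exact: cochain_eval_continuous|exact: Tc].
  exact: cochain_insertion_continuous.
- move=> phi; apply/funext => t; rewrite Tcob coboundary_insertion0.
  by rewrite -BE /= TK.
- move=> n phi; apply/funext => t; rewrite Tcob.
  have := coboundary_insertion pi (T \o phi : cochain G X n.+1) t cs.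
  by rewrite -BE /= TK.
Qed.
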